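(* Let $1<p<r<\infty$. There is a constant $c_{pr}>0$, depending only on $p$ and $r$ (independent of $X$, $Y$, $T$ and $n$), such that for all Banach spaces $X,Y$, all $T\in\mathcal{L}(X,Y)$ and all $n=1,2,\dots$ $$\frac{1}{c_{pr}}\,RUMD_n^p(T)\le RUMD_n^r(T)\le c_{pr}\,RUMD_n^p(T).$$
   Context: Banach spaces are over $\mathbb{K}$ (the real or complex scalars); $\mathcal{L}(X,Y)$ is the space of bounded linear operators from $X$ to $Y$. Let $\Omega_n=\{-1,1\}^n$ with the uniform probability $\mu_n(\{\omega\})=2^{-n}$, let $\mathcal{F}_0=\{\emptyset,\Omega_n\}$ and let $\mathcal{F}_k$ be the $\sigma$-algebra generated by the coordinates $\omega_1,\dots,\omega_k$. A Walsh-Paley martingale $\{M_k\}_0^n$ with values in $X$ is an $X$-valued martingale over $(\Omega_n,\mu_n)$ with respect to $\{\mathcal{F}_k\}_0^n$; $dM_k:=M_k-M_{k-1}$ for $k\ge1$. Let also $D_n=\{-1,1\}^n$ with uniform probability $P_n$; $\mathbb{E}_{\varepsilon,\omega}$ is the expectation with respect to $P_n\times\mu_n$ ($\varepsilon\in D_n$, $\omega\in\Omega_n$). For $1\le q<\infty$ and $T\in\mathcal{L}(X,Y)$, $RUMD_n^q(T)$ is the infimum of all $c>0$ such that $$\Big(\mathbb{E}_{\varepsilon,\omega}\Big\|\sum_{k=1}^n\varepsilon_k\,T\,dM_k(\omega)\Big\|^q\Big)^{1/q}\le c\,\big(\mathbb{E}_\omega\|M_n(\omega)\|^q\big)^{1/q}$$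 for all Walsh-Paley martingales $\{M_k\}_0^n$ with values in $X$ and $M_0=0$. *)

(* Defs.v *)
From HB Require Import structures.
From mathcomp Require Import all_boot all_order all_algebra.
From mathcomp Require Import complex.
From mathcomp Require Import all_classical all_reals all_analysis.

Set Implicit Arguments.
Unset Strict Implicit.
Unset Printing Implicit Defensive.

Import Order.TTheory GRing.Theory Num.Theory.
Import numFieldNormedType.Exports.

Local Open Scope classical_set_scope.
Local Open Scope ring_scope.

(* The cube {-1,1}^n.  A sign is stored as a boolean b standing for (-1)^b,
   so that the sign of coordinate k of w is (-1) ^+ w k. *)
Definition cube (n : nat) : finType := {ffun 'I_n -> bool}.

(* Expectations for the uniform probability on a finite set.  On [cube n] each
   point has mass 2^-n, and on [cube n * cube n] this is the product of the
   uniform probabilities of the factors. *)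
Definition expect_on (K : numFieldType) (V : lmodType K) (T : finType)
    (A : set T) (f : T -> V) : V :=
  \sum_(t : T | t \in A) (#|T|%:R^-1 : K) *: f t.

Definition rexpect (R : realType) (T : finType) (f : T -> R) : R :=
  expect_on setT (f : T -> R^o).

(* The sigma-algebra generated by the first k coordinates. *)
Definition coord_filtration (n k : nat) : set_system (cube n) :=
  <<s [set A | exists (i : 'I_n) (b : bool),
         (i < k)%N /\ A = [set w : cube n | w i = b] ]>>.

Arguments coord_filtration : clear implicits.

Definition borel_measurable_wrt (K : numFieldType) (X : normedModType K)
    (T : Type) (F : set_system T) (f : T -> X) : Prop :=
  forall B : set X, <<s (@open X) >> B -> F (f @^-1` B).

(* g is (a version of) the conditional expectation E(f | F). *)
Definition is_cond_expect (K : numFieldType) (X : normedModType K)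
    (T : finType) (F : set_system T) (f g : T -> X) : Prop :=
  borel_measurable_wrt F g /\
  forall A : set T, F A -> expect_on A g = expect_on A f.

(* Only the values M 0, ..., M n of the sequence matter. *)
Definition walsh_paley_martingale (K : numFieldType) (X : normedModType K)
    (n : nat) (M : nat -> cube n -> X) : Prop :=
  (forall k, (k <= n)%N -> borel_measurable_wrt (coord_filtration n k) (M k)) /\
  (forall k, (k < n)%N ->
     is_cond_expect (coord_filtration n k) (M k.+1) (M k)).

Definition mdiff (T : Type) (X : zmodType) (M : nat -> T -> X) (k : nat)
    (w : T) : X := M k w - M k.-1 w.

(* Norms of a normed K-module take their values in K.  The map [re : K -> R]
   turns them into real numbers: it is the identity for K = R and the real part
   for K = R[i].  The index k : 'I_n stands for the time k.+1. *)
Definition RUMD (R : realType) (K : numFieldType) (re : K -> R)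
    (X Y : completeNormedModType K) (T : {linear X -> Y}) (q : R) (n : nat)
    : \bar R :=
  ereal_inf [set c%:E | c in [set c : R | 0 < c /\
    forall M : nat -> cube n -> X,
      walsh_paley_martingale M -> (forall w, M 0%N w = 0) ->
      rexpect (fun ew : cube n * cube n =>
          re `|\sum_(k < n) ((-1) ^+ ew.1 k : K) *: T (mdiff M k.+1 ew.2)| `^ q)
        `^ q^-1
      <= c * rexpect (fun w : cube n => re `|M n w| `^ q) `^ q^-1]].

(* Main.v *)
Require Import Defs.
From HB Require Import structures.
From mathcomp Require Import all_boot all_order all_algebra.
From mathcomp Require Import complex.
From mathcomp Require Import all_classical all_reals all_analysis.
From mathcomp Require Import ring lra.

Set Implicit Arguments.
Unset Strict Implicit.
Unset Printing Implicit Defensive.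

Import Order.TTheory GRing.Theory Num.Theory.
Import numFieldNormedType.Exports.

Local Open Scope classical_set_scope.
Local Open Scope ring_scope.

(* Both inequalities come from one extrapolation statement, which passes from any
   exponent p > 1 to any exponent q > 1.  Put
     S(w) = (E_e || sum_k e_k T dM_k(w) ||^p)^(1/p),   M* = max_k ||M_k||.
   By the contraction principle the truncations S_k of S increase with k, and on
   the Walsh-Paley filtration ||dM_k|| is predictable.  Starting M when S_k
   exceeds l and stopping it before M_k or dM_k becomes larger than t l / c gives
   a bounded martingale; the L_p inequality applied to it yields a good-lambda
   inequality
     P(S > 12 l, M* <= t l / (2 c)) <= (3 t)^p P(S > l),
   hence ||S||_q <= C c ||M*||_q, and Doob's inequality bounds M*.  Kahane's
   inequality, again a good-lambda inequality followed by Doob's, replaces the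
   L_p norm in e by the L_q norm.  The argument uses of the norms only
   N(x + y) <= N x + N y, N(-x) = N x, N(x + x) = 2 N x, and of T only additivity,
   so it treats both scalar fields at once. *)

(** * Expectations and powers *)

Section expectation.
Context (R : realType).
Implicit Types (T U : finType).

Lemma rexpectE T (f : T -> R) : rexpect f = #|T|%:R^-1 * \sum_t f t.
Proof.
rewrite /rexpect /expect_on mulr_sumr; apply: eq_big => [t|t _ //].
by rewrite in_setT.
Qed.

Lemma eq_rexpect T (f g : T -> R) : f =1 g -> rexpect f = rexpect g.
Proof. by move=> fg; rewrite !rexpectE; congr (_ * _); apply: eq_bigr. Qed.

Lemma ler_rexpect T (f g : T -> R) :
  (forall t, f t <= g t) -> rexpect f <= rexpect g.
Proof.
by move=> fg; rewrite !rexpectE ler_wpM2l ?invr_ge0 ?ler0n// ler_sum.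
Qed.

Lemma rexpect_ge0 T (f : T -> R) : (forall t, 0 <= f t) -> 0 <= rexpect f.
Proof. by move=> f0; rewrite rexpectE mulr_ge0 ?invr_ge0 ?ler0n ?sumr_ge0. Qed.

Lemma rexpectD T (f g : T -> R) :
  rexpect (fun t => f t + g t) = rexpect f + rexpect g.
Proof. by rewrite !rexpectE big_split mulrDr. Qed.

Lemma rexpectZ T (a : R) (f : T -> R) :
  rexpect (fun t => a * f t) = a * rexpect f.
Proof. by rewrite !rexpectE -mulr_sumr mulrCA. Qed.

Lemma rexpect_sum T (I : Type) (s : seq I) (P : pred I) (f : I -> T -> R) :
  rexpect (fun t => \sum_(i <- s | P i) f i t) = \sum_(i <- s | P i) rexpect (f i).
Proof.
rewrite rexpectE exchange_big mulr_sumr.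
by apply: eq_bigr => i _; rewrite rexpectE.
Qed.

Lemma rexpect_cst T (a : R) : (0 < #|T|)%N -> rexpect (fun _ : T => a) = a.
Proof.
move=> T0; rewrite rexpectE sumr_const -[a *+ _]mulr_natl mulrA mulVf ?mul1r//.
by rewrite pnatr_eq0 -lt0n.
Qed.

(** Only an inequality, since over an empty [T] the expectation is 0 by the convention
    [0^-1 = 0]. *)
Lemma rexpect_cst_le T (a : R) : 0 <= a -> rexpect (fun _ : T => a) <= a.
Proof.
have [T0 a0|T0 _] := posnP #|T|; last by rewrite rexpect_cst.
by rewrite rexpectE T0 invr0 mul0r.
Qed.

Lemma rexpect_inj T (h : T -> T) (f : T -> R) :
  injective h -> rexpect (fun t => f (h t)) = rexpect f.
Proof. by move=> hI; rewrite !rexpectE [in RHS](reindex_inj hI). Qed.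

Lemma rexpect_pair T U (f : T -> U -> R) :
  rexpect (fun tu : T * U => f tu.1 tu.2) =
  rexpect (fun t => rexpect (fun u => f t u)).
Proof.
rewrite rexpectE -(pair_bigA _ f) card_prod natrM invfM -mulrA rexpectE.
by congr (_ * _); rewrite mulr_sumr; apply: eq_bigr => t _; rewrite rexpectE.
Qed.

Lemma rexpect_exchange T U (f : T -> U -> R) :
  rexpect (fun t => rexpect (fun u => f t u)) =
  rexpect (fun u => rexpect (fun t => f t u)).
Proof.
rewrite rexpectE mulr_sumr.
rewrite (@eq_rexpect _ _ (fun u => \sum_t #|T|%:R^-1 * f t u)); last first.
  by move=> u; rewrite rexpectE mulr_sumr.
by rewrite rexpect_sum; apply: eq_bigr => t _; rewrite rexpectZ.
Qed.

End expectation.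

Section powR_extra.
Context (R : realType).
Implicit Types (x y a b q : R).

Lemma le_powR_base x y q : 0 <= q -> 0 <= x -> x <= y -> x `^ q <= y `^ q.
Proof.
move=> q0 x0 xy; apply: ge0_ler_powR => //; rewrite nnegrE//.
exact: le_trans xy.
Qed.

Lemma lt_powR_base x y q : 0 < q -> 0 <= x -> x < y -> x `^ q < y `^ q.
Proof.
move=> q0 x0 xy; apply: gt0_ltr_powR => //; rewrite nnegrE//.
exact: le_trans (ltW xy).
Qed.

Lemma powRK x q : 0 <= x -> q != 0 -> (x `^ q) `^ q^-1 = x.
Proof. by move=> x0 q0; rewrite -powRrM divff// powRr1. Qed.

Lemma powRVK x q : 0 <= x -> q != 0 -> (x `^ q^-1) `^ q = x.
Proof. by move=> x0 q0; rewrite -powRrM mulVf// powRr1. Qed.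

Lemma powRD_le x y q : 0 <= q -> 0 <= x -> 0 <= y ->
  (x + y) `^ q <= 2 `^ q * (x `^ q + y `^ q).
Proof.
move=> q0; wlog yx : x y / y <= x => [H x0 y0|x0 y0].
  by have [/H|/ltW/H] := leP y x; [exact|rewrite addrC [_ `^ q + _]addrC; exact].
apply: (@le_trans _ _ ((2 * x) `^ q)).
  by apply: le_powR_base; rewrite ?addr_ge0//; lra.
by rewrite powRM// ler_wpM2l ?powR_ge0// lerDl powR_ge0.
Qed.

Lemma midpoint_powR x y q : 1 <= q -> 0 <= x -> 0 <= y ->
  2 * ((x + y) / 2) `^ q <= x `^ q + y `^ q.
Proof.
move=> q1 x0 y0.
have h : 0 <= (2^-1 : R) <= 1 by apply/andP; split; lra.
have := convex_powR q1 (Itv01 (proj1 (andP h)) (proj2 (andP h))) (x := x) (y := y).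
rewrite !inE/= !in_itv/= !andbT => /(_ x0 y0).
rewrite !convRE; set z := (X in X `^ q <= _ -> _).
have -> : z = (x + y) / 2.
  change (2^-1 * x + unstable.onem 2^-1 * y = (x + y) / 2).
  by rewrite /unstable.onem; lra.
by rewrite /= /unstable.onem; lra.
Qed.

(** Young's inequality for [x] and [y ^ (q - 1)] with the conjugate exponents [q] and [q / (q - 1)],
    multiplied by [q]. *)
Lemma young_powR x y q : 1 < q -> 0 <= x -> 0 <= y ->
  q * (x * y `^ (q - 1)) <= x `^ q + (q - 1) * y `^ q.
Proof.
move=> q1 x0 y0; have q0 : 0 < q by lra.
have q10 : 0 < q - 1 by lra.
have := @conjugate_powR _ x (y `^ (q - 1)) q (q / (q - 1)) x0 (powR_ge0 _ _) q0
  (divr_gt0 q0 q10).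
rewrite -powRrM [(q - 1) * _]mulrC divfK ?gt_eqF//.
have -> : q^-1 + (q / (q - 1))^-1 = 1.
  by rewrite invf_div -{1}(mul1r q^-1) -mulrDl addrC subrK divff ?gt_eqF.
move=> /(_ erefl) /(ler_wpM2l (ltW q0)) /le_trans; apply.
rewrite mulrDr invf_div mulrC divfK ?gt_eqF// lerD2l.
by rewrite mulrCA [q * _]mulrC divfK ?gt_eqF// mulrC.
Qed.

(* With scales s 2^j, j < J, this sum is comparable to x^q up to the error s^q. *)
Definition dyadic_powR (q s : R) (J : nat) (x : R) : R :=
  \sum_(j < J) (s * 2 ^+ j) `^ q * (s * 2 ^+ j < x)%R%:R.

Lemma dyadic_powR_ge0 q s J x : 0 <= dyadic_powR q s J x.
Proof. by apply: sumr_ge0 => j _; rewrite mulr_ge0 ?powR_ge0. Qed.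

(** If [x] exceeds [s], the largest of the scales below [x] is at least [x / 2], and its term alone
    gives the bound. *)
Lemma powR_le_dyadic q s J x : 0 < q -> 0 < s -> 0 <= x -> x <= s * 2 ^+ J ->
  x `^ q <= s `^ q + 2 `^ q * dyadic_powR q s J x.
Proof.
move=> q0 s0 x0; elim: J => [|J IHJ] xJ.
  rewrite /dyadic_powR big_ord0 mulr0 addr0 le_powR_base ?(ltW q0)//.
  by rewrite expr0 mulr1 in xJ.
rewrite /dyadic_powR big_ord_recr /= -/(dyadic_powR q s J x).
have [/IHJ xJ'|Jx] := leP x (s * 2 ^+ J); first by rewrite mulr0 addr0.
rewrite mulr1 mulrDr addrA -powRM//; last by rewrite mulr_ge0 ?exprn_ge0// ltW.
apply: (@le_trans _ _ ((2 * (s * 2 ^+ J)) `^ q)).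
  by apply: le_powR_base; rewrite ?(ltW q0)// mulrCA -exprS.
by rewrite lerDr addr_ge0 ?mulr_ge0 ?powR_ge0 ?dyadic_powR_ge0.
Qed.

(** As [1 <= q], consecutive powers of the scales grow at least by a factor 2, so the sum is at most
    twice its last nonzero term. *)
Lemma dyadic_powR_le q s J x : 1 <= q -> 0 < s -> 0 <= x ->
  dyadic_powR q s J x <= 2 * x `^ q.
Proof.
move=> q1 s0 x0; have q0 : 0 <= q by lra.
have full j : \sum_(i < j.+1) (s * 2 ^+ i) `^ q <= 2 * (s * 2 ^+ j) `^ q.
  elim: j => [|j IHj]; first by rewrite big_ord1 mulrDl mul1r lerDl powR_ge0.
  rewrite big_ord_recr /= (mulrDl _ _ ((s * 2 ^+ j.+1) `^ q)) !mul1r lerD2r.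
  apply: (le_trans IHj).
  have s2 : 0 <= s * 2 ^+ j by rewrite mulr_ge0 ?exprn_ge0// ltW.
  rewrite exprS (mulrCA s) [in leRHS]powRM// ler_wpM2r ?powR_ge0//.
  by apply: le1r_powR => //; lra.
elim: J => [|J IHJ]; first by rewrite /dyadic_powR big_ord0 mulr_ge0 ?powR_ge0.
have [Jx|xJ] := ltP (s * 2 ^+ J) x; last first.
  by rewrite /dyadic_powR big_ord_recr /= ltNge xJ mulr0 addr0.
apply: (@le_trans _ _ (\sum_(i < J.+1) (s * 2 ^+ i) `^ q)).
  apply: ler_sum => i _; rewrite -[leRHS]mulr1 ler_wpM2l ?powR_ge0//.
  by case: (_ < _); rewrite ?lexx ?ler01.
apply: (le_trans (full J)); rewrite ler_wpM2l// le_powR_base ?(ltW Jx)//.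
by rewrite mulr_ge0 ?exprn_ge0// ltW.
Qed.

End powR_extra.

(* The distribution functions are summed over the scales s 2^j instead of being
   integrated; the error s^q is removed by letting s tend to 0. *)
Lemma good_lambda (R : realType) (T : finType) (q a b : R) (f f' g : T -> R) :
  1 <= q -> 0 <= a -> 0 < b ->
  (forall t, 0 <= f t) -> (forall t, 0 <= f' t) -> (forall t, 0 <= g t) ->
  (forall l, 0 < l ->
    rexpect (fun t => ((b * l < f t) && (g t <= l))%R%:R : R) <=
    a * rexpect (fun t => (l < f' t)%R%:R)) ->
  rexpect (fun t => f t `^ q) <=
  2 * (2 * b) `^ q * (a * rexpect (fun t => f' t `^ q) + rexpect (fun t => g t `^ q)).
Proof.
move=> q1 a0 b0 f0 f'0 g0 H; have q0 : 0 < q by lra.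
have step s : 0 < s -> rexpect (fun t => f t `^ q) <= b `^ q * s `^ q +
    2 * (2 * b) `^ q * (a * rexpect (fun t => f' t `^ q) + rexpect (fun t => g t `^ q)).
  move=> s0.
  have fb0 t : 0 <= b^-1 * f t by rewrite mulr_ge0 ?invr_ge0// ltW.
  have [J HJ] : exists J : nat, forall t, b^-1 * f t <= s * 2 ^+ J.
    pose B := \sum_t b^-1 * f t; have B0 : 0 <= B by apply: sumr_ge0.
    exists (Num.truncn (B / s)).+1 => t.
    have fB : b^-1 * f t <= B by rewrite /B (bigD1 t)//= lerDl sumr_ge0.
    apply: (le_trans fB); rewrite mulrC -ler_pdivrMr//.
    apply: (le_trans (ltW (truncnS_gt _))).
    by rewrite -natrX ler_nat ltnW// ltn_expl.
  (* The event [b * l < f t] is split according to whether [g t <= l]; the hypothesis covers one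
     half, and [l < g t] on the other. *)
  have dist l : 0 < l -> rexpect (fun t => (l < b^-1 * f t)%R%:R : R) <=
      a * rexpect (fun t => (l < f' t)%R%:R) + rexpect (fun t => (l < g t)%R%:R).
    move=> l0; apply: le_trans (lerD (H l l0) (lexx _)); rewrite -rexpectD.
    apply: ler_rexpect => t; rewrite -ltr_pdivrMl ?invr_gt0// invrK.
    rewrite (leNgt (g t)); case: (_ < _); case: (_ < _) => //=;
      by rewrite ?addr0 ?add0r ?lexx ?ler01.
  have dyad (h : T -> R) : rexpect (fun t => dyadic_powR q s J (h t)) =
      \sum_(j < J) (s * 2 ^+ j) `^ q * rexpect (fun t => (s * 2 ^+ j < h t)%R%:R).
    rewrite /dyadic_powR rexpect_sum; apply: eq_bigr => j _; exact: rexpectZ.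
  have sum_dist : rexpect (fun t => dyadic_powR q s J (b^-1 * f t)) <=
      a * rexpect (fun t => dyadic_powR q s J (f' t)) +
      rexpect (fun t => dyadic_powR q s J (g t)).
    rewrite !dyad mulr_sumr -big_split; apply: ler_sum => j _ /=.
    rewrite mulrCA -mulrDr ler_wpM2l ?powR_ge0// dist// mulr_gt0// exprn_gt0//.
  have upper (h : T -> R) : (forall t, 0 <= h t) ->
      rexpect (fun t => dyadic_powR q s J (h t)) <= 2 * rexpect (fun t => h t `^ q).
    by move=> h0; rewrite -rexpectZ; apply: ler_rexpect => t; exact: dyadic_powR_le.
  have E t : f t `^ q = b `^ q * (b^-1 * f t) `^ q.
    by rewrite -powRM ?(ltW b0)// mulrA mulfV ?gt_eqF// mul1r.
  rewrite (eq_rexpect E) rexpectZ.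
  apply: (@le_trans _ _ (b `^ q * (s `^ q + 2 `^ q *
      rexpect (fun t => dyadic_powR q s J (b^-1 * f t))))).
    rewrite ler_wpM2l ?powR_ge0// -rexpectZ.
    apply: le_trans (lerD (@rexpect_cst_le _ T _ (powR_ge0 s q)) (lexx _)).
    rewrite -rexpectD; apply: ler_rexpect => t; exact: powR_le_dyadic.
  rewrite mulrDr lerD2l mulrA powRM ?(ltW b0)//.
  rewrite (_ : 2 * (2 `^ q * b `^ q) * _ = b `^ q * 2 `^ q * (
    a * (2 * rexpect (fun t => f' t `^ q)) + 2 * rexpect (fun t => g t `^ q))); last lra.
  rewrite ler_wpM2l ?mulr_ge0 ?powR_ge0//.
  apply: (le_trans sum_dist); apply: lerD; last exact: upper.
  by rewrite ler_wpM2l// upper.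
apply/ler_addgt0Pr => e e0.
have bq : 0 < b `^ q by rewrite powR_gt0.
(* This scale makes the error [b ^ q * s ^ q] equal to [e]. *)
have := step ((e / b `^ q) `^ q^-1).
rewrite powR_gt0 ?divr_gt0// => /(_ isT).
rewrite powRVK ?gt_eqF ?divr_ge0 ?(ltW e0) ?(ltW bq)//.
by rewrite mulrC divfK ?gt_eqF// addrC.
Qed.

(** * Walsh-Paley differences and Rademacher sums *)

Section cube.
Context (n : nat).
Implicit Types (w e : cube n) (i j k : 'I_n).

(** The classes of this relation are the atoms of the sigma-algebra of the first [m] coordinates. *)
Definition agree (m : nat) w e := forall i, (i < m)%N -> w i = e i.

Definition flip k w : cube n := [ffun i => w i (+) (i == k)].

Lemma flipK k : involutive (flip k).
Proof. by move=> w; apply/ffunP => i; rewrite !ffunE addbK. Qed.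

Lemma agree_flip k w : agree k w (flip k w).
Proof. by move=> i ik; rewrite ffunE -val_eqE ltn_eqF ?addbF. Qed.

Arguments agree_flip : clear implicits.

Lemma agree_le (m m' : nat) w e : (m <= m')%N -> agree m' w e -> agree m w e.
Proof. by move=> mm' H i im; apply: H; exact: leq_trans mm'. Qed.

Lemma agree_succ k w e : agree k w e ->
  agree k.+1 w e \/ agree k.+1 (flip k w) e.
Proof.
move=> H; have [kE|kN] := eqVneq (w k) (e k); [left|right] => i.
  rewrite ltnS leq_eqVlt => /orP[/eqP/val_inj->//|]; exact: H.
rewrite ltnS leq_eqVlt ffunE => /orP[/eqP/val_inj->|ik].
  by rewrite eqxx; move: kN; case: (w k); case: (e k).
by rewrite -val_eqE ltn_eqF// addbF H.
Qed.

Lemma card_cube_gt0 : (0 < #|cube n|)%N.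
Proof. by apply/card_gt0P; exists [ffun=> false]. Qed.

(** Isolates the last index before a stopping time, where the overshoot has to be estimated. *)
Lemma initial_segment (B : pred 'I_n) : (forall i j, (i <= j)%N -> B j -> B i) ->
  B =1 xpred0 \/ exists2 i, B i & forall j, B j = (j <= i)%N.
Proof.
move=> Bdec; case: (pickP B) => [i0 Bi0|B0]; [right|by left].
case: (arg_maxnP (fun i => i : nat) Bi0) => i Bi imax; exists i => // j.
by apply/idP/idP => [/imax//|ji]; exact: Bdec Bi.
Qed.

Section sums.
Context (X : zmodType).
Implicit Types (f : 'I_n -> X).

Definition psum f (m : nat) : X := \sum_(i < n | (i < m)%N) f i.

Lemma psum0 f : psum f 0 = 0.
Proof. by rewrite /psum big_pred0. Qed.

Lemma psumS f k : psum f k.+1 = psum f k + f k.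
Proof.
rewrite /psum (bigD1 k) ?ltnS//= addrC; congr (_ + _).
by apply: eq_bigl => i; rewrite ltnS ltn_neqAle andbC.
Qed.

Lemma psum_full f : psum f n = \sum_i f i.
Proof. by apply: eq_bigl => i; rewrite ltn_ord. Qed.

(** Given the first [k] signs, the next sign has two equally likely values, so a vanishing
    conditional expectation means oddness in coordinate [k]. The index [k] stands for time
    [k.+1]. *)
Definition mdiffs (d : 'I_n -> cube n -> X) := forall k,
  (forall w e, agree k.+1 w e -> d k w = d k e) /\
  (forall w, d k (flip k w) = - d k w).

Definition predictable (A : Type) (P : 'I_n -> cube n -> A) :=
  forall k w e, agree k w e -> P k w = P k e.

Lemma mdiffs_psum d (m : nat) w e : mdiffs d -> agree m w e ->
  psum (d^~ w) m = psum (d^~ e) m.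
Proof.
move=> md we; apply: eq_bigr => i im; apply: (md i).1; exact: agree_le we.
Qed.

(** This makes the norm of [d k] predictable: the past determines [d k] up to sign. *)
Lemma mdiffs_sign d k w e : mdiffs d -> agree k w e ->
  d k e = d k w \/ d k e = - d k w.
Proof.
move=> md /agree_succ[/(md k).1->|/(md k).1<-]; [by left|right].
exact: (md k).2.
Qed.

(** A martingale transform: oddness in coordinate [k] survives because [P k] does not see that
    coordinate. *)
Lemma mdiffs_stop d (P : 'I_n -> cube n -> bool) : mdiffs d -> predictable P ->
  mdiffs (fun i w => if P i w then d i w else 0).
Proof.
move=> md pP k; split=> [w e we|w].
  by rewrite (pP k w e) ?((md k).1 w e)//; exact: agree_le we.
rewrite -(pP k w _ (agree_flip k w)); case: (P k w); last by rewrite oppr0.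
exact: (md k).2.
Qed.

End sums.
End cube.

Arguments agree_flip {n}.

Section signs.
Context (X : zmodType).

(** Signs act through the group structure alone, so that no scalar field enters the estimates. *)
Definition sgn (b : bool) (x : X) : X := if b then - x else x.

Lemma sgn_addb a b x : sgn (a (+) b) x = sgn a (sgn b x).
Proof. by case: a; case: b => //=; rewrite opprK. Qed.

Lemma sgn_negb b x : sgn (~~ b) x = - sgn b x.
Proof. by case: b => //=; rewrite opprK. Qed.

Lemma mdiffs_sgn n (y : 'I_n -> X) : mdiffs (fun i (w : cube n) => sgn (w i) (y i)).
Proof.
move=> k; split=> [w e we|w]; first by rewrite we.
by rewrite ffunE eqxx addbT sgn_negb.
Qed.

End signs.

Section running_maximum.
Context (R : realType).
Implicit Types (x : nat -> R).

Fixpoint runmax x (m : nat) : R :=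
  if m is m'.+1 then Num.max (runmax x m') (x m) else x 0%N.

Lemma le_runmax x (j m : nat) : (j <= m)%N -> x j <= runmax x m.
Proof.
elim: m => [|m IHm]; first by rewrite leqn0 => /eqP->.
rewrite leq_eqVlt => /orP[/eqP->|/IHm] /=; rewrite le_max ?lexx ?orbT// => ->//.
Qed.

Lemma runmax_mono x (j m : nat) : (j <= m)%N -> runmax x j <= runmax x m.
Proof.
elim: m => [|m IHm]; first by rewrite leqn0 => /eqP->.
by rewrite leq_eqVlt => /orP[/eqP->//|/IHm] /=; rewrite le_max => ->.
Qed.

Lemma eq_runmax x x' (m : nat) : (forall j, (j <= m)%N -> x j = x' j) ->
  runmax x m = runmax x' m.
Proof.
elim: m => [|m IHm] H /=; first exact: H.
by rewrite IHm ?H// => j jm; apply: H; exact: leqW.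
Qed.

End running_maximum.

(** * Inequalities for signed sums and martingales in a seminormed group *)

Section seminorm.
Context (R : realType).

(** The doubling rule stands in for homogeneity: it gives [N 0 = 0] and allows averaging over two
    points without dividing in [X]. *)
Definition seminorm (X : zmodType) (N : X -> R) :=
  [/\ forall x y, N (x + y) <= N x + N y, forall x, N (- x) = N x &
      forall x, N (x + x) = 2 * N x].

Section basics.
Context (X : zmodType) (N : X -> R) (hN : seminorm N).

Lemma seminormD x y : N (x + y) <= N x + N y.
Proof. by case: hN. Qed.

Lemma seminormN x : N (- x) = N x.
Proof. by case: hN. Qed.

Lemma seminorm2 x : N (x + x) = 2 * N x.
Proof. by case: hN. Qed.

Lemma seminorm0 : N 0 = 0.
Proof. by have := seminorm2 0; rewrite addr0; lra. Qed.

Lemma seminorm_ge0 x : 0 <= N x.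
Proof. by have := seminormD x (- x); rewrite subrr seminorm0 seminormN; lra. Qed.

Lemma seminorm_sgn b x : N (sgn b x) = N x.
Proof. by case: b; rewrite /= ?seminormN. Qed.

(** The sum is the partial sum before the last index of [B], plus the term at that index. *)
Lemma seminorm_initial_sum n (f : 'I_n -> X) (B : pred 'I_n) (a b : R) :
  0 <= a -> 0 <= b -> (forall i j : 'I_n, (i <= j)%N -> B j -> B i) ->
  (forall i, B i -> N (psum f i) <= a /\ N (f i) <= b) ->
  N (\sum_(i < n | B i) f i) <= a + b.
Proof.
move=> a0 b0 /initial_segment[B0|[i Bi BE]] H.
  by rewrite big_pred0// seminorm0 addr_ge0.
rewrite (eq_bigl _ _ BE) -[X in N X]/(psum f i.+1) psumS.
by apply: (le_trans (seminormD _ _)); case: (H i Bi); exact: lerD.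
Qed.

(** Flipping the signs outside [A] preserves the law, and the mean of the two sums over [B] is the
    sum over [A]; convexity of the power concludes. *)
Lemma contraction_principle n (p : R) (y : 'I_n -> X) (A B : pred 'I_n) :
  1 <= p -> subpred A B ->
  rexpect (fun e : cube n => N (\sum_(i < n | A i) sgn (e i) (y i)) `^ p) <=
  rexpect (fun e : cube n => N (\sum_(i < n | B i) sgn (e i) (y i)) `^ p).
Proof.
move=> p1 AB; set F := fun e : cube n => N (\sum_(i < n | B i) _) `^ p.
pose h (e : cube n) : cube n := [ffun i => e i (+) ~~ A i].
have hI : injective h.
  by apply: (can_inj (g := h)) => e; apply/ffunP => i; rewrite !ffunE addbK.
suff: 2 * rexpect (fun e : cube n => N (\sum_(i < n | A i) sgn (e i) (y i)) `^ p) <=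
    rexpect F + rexpect (fun e => F (h e)) by rewrite (rexpect_inj _ hI); lra.
rewrite -rexpectZ -rexpectD; apply: ler_rexpect => e.
apply: le_trans (midpoint_powR p1 (seminorm_ge0 _) (seminorm_ge0 _)).
rewrite ler_wpM2l// le_powR_base ?seminorm_ge0//; first lra.
rewrite ler_pdivlMr// mulrC -seminorm2; apply: le_trans (seminormD _ _).
rewrite -!big_split (bigID A B)/= [X in _ + X]big1 => [|i /andP[_ nA]]; last first.
  by rewrite ffunE nA addbT sgn_negb subrr.
rewrite addr0 le_eqVlt; apply/orP; left; apply/eqP; congr N.
apply: eq_big => [i|i Ai].
  by apply/idP/andP => [Ai|[]//]; split=> //; exact: AB.
by rewrite ffunE Ai addbF.
Qed.

Lemma rademacher_sgn n (p : R) (y : 'I_n -> X) (b : 'I_n -> bool) :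
  rexpect (fun e : cube n => N (\sum_i sgn (e i) (sgn (b i) (y i))) `^ p) =
  rexpect (fun e : cube n => N (\sum_i sgn (e i) (y i)) `^ p).
Proof.
pose h (e : cube n) : cube n := [ffun i => e i (+) b i].
have hI : injective h.
  by apply: (can_inj (g := h)) => e; apply/ffunP => i; rewrite !ffunE addbK.
rewrite -[RHS](rexpect_inj _ hI); apply: eq_rexpect => e.
by congr (N _ `^ p); apply: eq_bigr => i _; rewrite ffunE sgn_addb.
Qed.

(** Averaging over the flip of coordinate [k] cancels [d k]. The weight [u] plays the part of
    conditioning on the past. *)
Lemma submartingale n (d : 'I_n -> cube n -> X) (u : cube n -> R) (k : 'I_n) :
  mdiffs d -> (forall w, 0 <= u w) -> (forall w, u (flip k w) = u w) ->
  rexpect (fun w => u w * N (psum (d^~ w) k)) <=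
  rexpect (fun w => u w * N (psum (d^~ w) k.+1)).
Proof.
move=> md u0 uk; set F := fun w => u w * N (psum (d^~ w) k.+1).
suff: 2 * rexpect (fun w => u w * N (psum (d^~ w) k)) <=
    rexpect F + rexpect (fun w => F (flip k w)).
  by rewrite (rexpect_inj _ (inv_inj (flipK k))); lra.
rewrite -rexpectZ -rexpectD; apply: ler_rexpect => w; rewrite /F uk -mulrDr mulrCA.
rewrite ler_wpM2l// -seminorm2; apply: le_trans (seminormD _ _).
rewrite !psumS -(mdiffs_psum md (agree_flip k w)) (md k).2.
by rewrite addrACA subrr addr0.
Qed.

(* Pathwise, [(q - 1) Y_k^q - q X_k Y_k^(q-1)] increases by at most
   [- q Y_k^(q-1) (X_(k+1) - X_k)], which has nonpositive expectation. *)
Lemma doob n (q : R) (d : 'I_n -> cube n -> X) : 1 < q -> mdiffs d ->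
  rexpect (fun w => runmax (fun m => N (psum (d^~ w) m)) n `^ q) <=
  2 `^ q / (q - 1) * rexpect (fun w => N (psum (d^~ w) n) `^ q).
Proof.
move=> q1 md; have q10 : 0 < q - 1 by lra.
pose x (m : nat) w := N (psum (d^~ w) m).
pose y (m : nat) w := runmax (x^~ w) m.
have x0 m w : 0 <= x m w by exact: seminorm_ge0.
have y0 m w : 0 <= y m w by apply: le_trans (le_runmax _ (leq0n m)).
pose U m w := (q - 1) * y m w `^ q - q * (x m w * y m w `^ (q - 1)).
have U_le0 (m : nat) : (m <= n)%N -> rexpect (U m) <= 0.
  elim: m => [_|m IHm mn].
    apply: (@le_trans _ _ (rexpect (fun _ : cube n => 0 : R))).
      apply: ler_rexpect => w; rewrite /U /y /= /x psum0 seminorm0 !powR0 ?gt_eqF//.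
        by rewrite !mulr0 subr0.
      by lra.
    by rewrite rexpect_cst ?card_cube_gt0.
  pose k := Ordinal mn.
  have step w : U m.+1 w <= U m w +
      - q * (y m w `^ (q - 1) * x m.+1 w) + q * (y m w `^ (q - 1) * x m w).
    rewrite /U {1 2}/y /= -/(y m w) -/(x m.+1 w).
    rewrite [Num.max _ _]/Order.max; case: ltP => [yx|_]; last nra.
    (* At a new maximum the left side is [- x m.+1 w ^ q], and the claim is Young's inequality;
       otherwise the two sides are equal. *)
    have := young_powR q1 (x0 m.+1 w) (y0 m w).
    rewrite (mulr_powRB1 (x0 _ _)); last lra.
    move: (x m w) (x m.+1 w) (_ `^ (q - 1)) (_ `^ q) (y m w `^ q) => *; nra.
  apply: (le_trans (ler_rexpect step)).
  rewrite rexpectD rexpectZ [X in X + _ <= _]rexpectD rexpectZ.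
  have : rexpect (fun w => y m w `^ (q - 1) * x m w) <=
      rexpect (fun w => y m w `^ (q - 1) * x m.+1 w).
    apply: (@submartingale _ _ (fun w => y m w `^ (q - 1)) k md) => w.
      exact: powR_ge0.
    congr (_ `^ _); apply: eq_runmax => j jm; congr N; apply/esym.
    apply: mdiffs_psum => //; apply: agree_le (agree_flip k w); exact: jm.
  move=> /(ler_wpM2l (ltW (lt_trans ltr01 q1))).
  by have := IHm (ltnW mn); lra.
(* Young's inequality is applied to [2 * x n w], so that half of [(q - 1) * y n w ^ q] survives. *)
have low w : (q - 1) / 2 * y n w `^ q + - (2^-1 * 2 `^ q) * x n w `^ q <= U n w.
  have := young_powR q1 (mulr_ge0 (ler0n R 2) (x0 n w)) (y0 n w).
  by rewrite powRM// /U; lra.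
have := le_trans (ler_rexpect low) (U_le0 n (leqnn n)).
rewrite rexpectD !rexpectZ => H.
rewrite -mulrA mulrCA mulrC ler_pdivlMr//; set a := rexpect _; set b := rexpect _.
by move: H; rewrite -/a -/b; lra.
Qed.

(* Flipping by an independent e the signs from the stopping time on does not
   change that time, nor the law of the signs. *)
Lemma rademacher_tail n (p : R) (y : 'I_n -> X) (P : 'I_n -> cube n -> bool) :
  1 <= p -> predictable P ->
  (forall w (i j : 'I_n), (i <= j)%N -> P i w -> P j w) ->
  rexpect (fun w : cube n => N (\sum_(i < n | P i w) sgn (w i) (y i)) `^ p) <=
  rexpect (fun e : cube n => N (\sum_i sgn (e i) (y i)) `^ p) *
  rexpect (fun w : cube n => [exists i, P i w]%:R).
Proof.
move=> p1 pP Pinc; set F := fun w : cube n => N (\sum_(i < n | P i w) _) `^ p.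
pose h (e w : cube n) : cube n := [ffun i => w i (+) (P i w && e i)].
(* Where [P i w] fails, no sign before [i] has been changed. Where it holds, the first index
   satisfying [P] is unaffected for the same reason, and monotonicity reaches [i]. *)
have Ph e w i : P i (h e w) = P i w.
  have agr j : ~~ P j w -> agree j w (h e w).
    move=> Pj k kj; rewrite ffunE (negbTE (contra (Pinc w k j (ltnW kj)) Pj)).
    by rewrite addbF.
  case Pi: (P i w); last by rewrite -(pP i w) ?Pi//; apply: agr; rewrite Pi.
  case: (@arg_minnP _ i (P^~ w) (fun j => j : nat) Pi) => j Pj jmin.
  apply: (Pinc _ j); first exact: jmin.
  rewrite -(pP j w)// => k kj; rewrite ffunE (_ : P k w = false) ?addbF//.
  by apply/negP => /jmin; rewrite leqNgt kj.
have hI e : injective (h e).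
  apply: (can_inj (g := h e)) => w; apply/ffunP => i.
  by rewrite ffunE Ph ffunE addbK.
(* Each [h e] permutes the cube, so an average over [e] may be inserted; it is then carried out
   first, with [w] fixed. *)
have -> : rexpect F = rexpect (fun e => rexpect (fun w => F (h e w))).
  rewrite -[LHS](rexpect_cst _ (card_cube_gt0 n)); apply: eq_rexpect => e.
  by rewrite rexpect_inj.
rewrite rexpect_exchange -rexpectZ; apply: ler_rexpect => w.
have FE e : F (h e w) = N (\sum_(i < n | P i w) sgn (e i) (sgn (w i) (y i))) `^ p.
  congr (N _ `^ p); apply: eq_big => [i|i]; rewrite Ph// => Pi.
  by rewrite ffunE Pi addbC sgn_addb.
rewrite (eq_rexpect FE); case: existsP => [_|noP].
  rewrite mulr1 -(rademacher_sgn p y w); exact: contraction_principle.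
rewrite mulr0 (@eq_rexpect _ _ _ (fun=> 0)) ?rexpect_cst ?card_cube_gt0// => e.
rewrite big_pred0 ?seminorm0 ?powR0 ?gt_eqF//; first lra.
by move=> i; apply/negP => Pi; apply: noP; exists i.
Qed.

End basics.
End seminorm.

(** * Kahane's inequality *)

Lemma small_powR (R : realType) (p a : R) : 0 < p -> 0 <= a ->
  exists2 x : R, 0 < x <= 1 & a * x `^ p <= 2^-1.
Proof.
move=> p0 a0; have b0 : 0 < 2 * a + 1 by lra.
exists ((2 * a + 1)^-1 `^ p^-1).
  rewrite powR_gt0 ?invr_gt0//=; have := @le_powR_base R (2 * a + 1)^-1 1 p^-1.
  rewrite powR1; apply; rewrite ?invr_ge0 ?(ltW p0) ?(ltW b0)//.
  by rewrite invf_le1//; lra.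
rewrite powRVK ?gt_eqF ?invr_ge0 ?(ltW b0)// ler_pdivrMr//; lra.
Qed.

(** Once the running maximum has passed [l], the remaining sum is controlled by [rademacher_tail],
    while the sum up to that time is at most [2 * l]. A final norm above [3 * l] thus forces a tail
    above [l]. *)
Lemma kahane (R : realType) (p q : R) : 1 < p -> 1 < q ->
  exists2 C : R, 0 < C &
  forall n (X : zmodType) (N : X -> R) (y : 'I_n -> X), seminorm N ->
  rexpect (fun e : cube n => N (\sum_i sgn (e i) (y i)) `^ q) <=
  C * (rexpect (fun e : cube n => N (\sum_i sgn (e i) (y i)) `^ p) `^ p^-1) `^ q.
Proof.
move=> p1 q1; have p0 : 0 < p by lra.
(* The factor of [good_lambda] with [b = 3], times the constant of [doob]; [t] is taken so small
   that the term in [t ^ p] can be absorbed on the left. *)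
have A0 : 0 <= 2 * (2 * 3) `^ q * (2 `^ q / (q - 1)).
  by rewrite !mulr_ge0 ?powR_ge0 ?invr_ge0//; lra.
have [t /andP[t0 t1] tA] := small_powR p0 A0.
exists (4 * (2 * 3) `^ q * t^-1 `^ q).
  by rewrite !mulr_gt0// powR_gt0 ?invr_gt0//; lra.
move=> n X N y hN; set E := rexpect (fun e => _ `^ p); set W := E `^ p^-1.
pose d i (e : cube n) := sgn (e i) (y i).
have md : mdiffs d by exact: mdiffs_sgn.
have E0 : 0 <= E by apply: rexpect_ge0 => e; exact: powR_ge0.
have W0 : 0 <= W by exact: powR_ge0.
have WE : W `^ p = E by rewrite powRVK// gt_eqF.
(* The contraction principle for the single index [i]. *)
have yW i : N (y i) <= W.
  rewrite -(@powRK _ (N (y i)) p) ?gt_eqF ?seminorm_ge0//.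
  apply: le_powR_base; rewrite ?powR_ge0 ?invr_ge0 ?(ltW p0)//.
  rewrite -[leLHS](rexpect_cst _ (card_cube_gt0 n)).
  apply: le_trans (contraction_principle hN y (A := pred1 i) (ltW p1) _) => //.
  apply: ler_rexpect => e; rewrite big_pred1_eq seminorm_sgn//.
pose x e m := N (psum (d^~ e) m).
have x0 e m : 0 <= x e m by exact: seminorm_ge0.
have fE (e : cube n) : N (\sum_i sgn (e i) (y i)) = x e n by rewrite /x psum_full.
have Wt0 : 0 <= t^-1 * W by rewrite mulr_ge0 ?invr_ge0 ?(ltW t0).
have GL := @good_lambda R (cube n) q (t `^ p) 3 (fun e => x e n)
  (fun e => runmax (x e) n) (fun=> t^-1 * W) (ltW q1) (powR_ge0 _ _) (ltr0n R 3)
  (fun e => x0 e n) (fun e => le_trans (x0 e n) (le_runmax _ (leqnn n))) (fun=> Wt0).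
rewrite (@eq_rexpect _ _ _ (fun e => x e n `^ q)) => [|e]; last by rewrite fE.
have {GL} GL := GL _.
suff /GL : forall l : R, 0 < l ->
    rexpect (fun e : cube n => ((3 * l < x e n) && (t^-1 * W <= l))%R%:R : R) <=
    t `^ p * rexpect (fun e => (l < runmax (x e) n)%R%:R).
  rewrite rexpect_cst ?card_cube_gt0// (@powRM _ t^-1 W) ?invr_ge0 ?(ltW t0)// => {}GL.
  have D := doob hN q1 md.
  have := ler_wpM2l (powR_ge0 t p) D => /(ler_wpM2l (powR_ge0 (2 * 3) q)) D'.
  have Z0 : 0 <= rexpect (fun e => x e n `^ q).
    by apply: rexpect_ge0 => e; exact: powR_ge0.
  have := ler_wpM2r Z0 tA.
  move: GL D'; set a := rexpect _; set z := rexpect _.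
  move: (t `^ p) ((2 * 3) `^ q) (2 `^ q / (q - 1)) (t^-1 `^ q) (W `^ q).
  move=> tp B K tq Wq H1 H2 H3.
  have -> : 4 * B * tq * Wq = 4 * (B * (tq * Wq)) by rewrite !mulrA.
  move: H1 H2 H3; rewrite mulrDr.
  have -> : 2 * B * (tp * z) = 2 * (B * (tp * z)) by rewrite !mulrA.
  have -> : 2 * B * (tq * Wq) = 2 * (B * (tq * Wq)) by rewrite !mulrA.
  have -> : 2 * B * K * tp * a = 2 * (B * (tp * (K * a))).
    by rewrite !mulrA (mulrAC _ K tp).
  move: (B * (tq * Wq)) (B * (tp * z)) (B * (tp * (K * a))) => *; lra.
(* For [l < t^-1 * W] the event on the left is empty, which is why this constant was taken as the
   third function. *)
move=> l l0; have [Wl|lW] := leP (t^-1 * W) l; last first.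
  rewrite (@eq_rexpect _ _ _ (fun=> 0)) => [|e]; last by rewrite andbF.
  rewrite rexpect_cst ?card_cube_gt0// mulr_ge0 ?powR_ge0 ?rexpect_ge0//.
have {}Wl : W <= t * l by rewrite -ler_pdivrMl.
have Wl1 : W <= l by apply: (le_trans Wl); rewrite ger_pMl.
pose P (i : 'I_n) e := l < runmax (x e) i.
have pP : predictable P.
  move=> k w e we; rewrite /P; congr (_ < _); apply: eq_runmax => j jk.
  by congr N; apply: mdiffs_psum => //; exact: agree_le we.
have Pinc w (i j : 'I_n) : (i <= j)%N -> P i w -> P j w.
  by move=> ij /lt_le_trans; apply; exact: runmax_mono.
have := rademacher_tail hN y (ltW p1) pP Pinc; rewrite -/E -WE => tail.
have lp : 0 < l `^ p by rewrite powR_gt0.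
rewrite -(ler_pM2l lp) mulrA -powRM ?(ltW l0) ?(ltW t0)// [l * t]mulrC.
apply: (@le_trans _ _ (W `^ p * rexpect (fun w => [exists i, P i w]%:R))).
  apply: le_trans tail; rewrite -rexpectZ; apply: ler_rexpect => e.
  rewrite andbT; case: ltP => [big|_]; last by rewrite mulr0 powR_ge0.
  rewrite mulr1; apply: le_powR_base; rewrite ?(ltW p0) ?(ltW l0)//.
  (* [P i] looks only at the terms before [i], so the last term with [~~ P i e] may overshoot [l],
     but by at most [W]. *)
  have : N (\sum_(i < n | ~~ P i e) d i e) <= l + W.
    apply: seminorm_initial_sum => //; first exact: ltW.
      by move=> i j ij; apply: contra; exact: Pinc.
    move=> i; rewrite /P -leNgt => Pi; split; last by rewrite seminorm_sgn.
    by apply: le_trans Pi; exact: (le_runmax (x e)).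
  move: big; rewrite /x psum_full (bigID (P^~ e))/= => big.
  have := seminormD hN (\sum_(i < n | P i e) d i e) (\sum_(i < n | ~~ P i e) d i e).
  by rewrite {2 3}/d in big *; lra.
apply: ler_pM; rewrite ?powR_ge0 ?rexpect_ge0//.
  by rewrite le_powR_base ?(ltW p0).
apply: ler_rexpect => e; case: existsP => [[i Pi]|_]; last by case: (_ < _).
by rewrite (lt_le_trans Pi)//; apply: runmax_mono; exact: ltnW.
Qed.

(** * Extrapolation *)

Section extrapolation.
Context (R : realType) (n : nat) (X Y : zmodType) (NX : X -> R) (NY : Y -> R).
Context (hX : seminorm NX) (hY : seminorm NY) (T : {additive X -> Y}).

(** The defining inequality of [RUMD] with both sides raised to the power [q], stated for
    differences; [RUMDE] proves the equivalence. *)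
Definition rumd_bound (q c : R) := forall d : 'I_n -> cube n -> X, mdiffs d ->
  rexpect (fun w : cube n => rexpect (fun e : cube n =>
    NY (\sum_i sgn (e i) (T (d i w))) `^ q)) <=
  c `^ q * rexpect (fun w => NX (\sum_i d i w) `^ q).

Lemma raddf_sgn b x : T (sgn b x) = sgn b (T x).
Proof. by case: b => //=; rewrite raddfN. Qed.

(** Tested on the martingale whose only nonzero difference is the [k]-th one, with values [x] and
    [- x]. *)
Lemma rumd_bound_norm (q c : R) (k : 'I_n) x : 0 < q -> 0 <= c ->
  rumd_bound q c -> NY (T x) <= c * NX x.
Proof.
move=> q0 c0 H; pose y (i : 'I_n) : X := if i == k then x else 0.
have sgn0 (Z : zmodType) b : sgn b (0 : Z) = 0 by case: b; rewrite /= ?oppr0.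
have XE (w : cube n) : NX (\sum_i sgn (w i) (y i)) = NX x.
  rewrite (bigD1 k)//= big1 => [|i /negbTE ik]; last by rewrite /y ik sgn0.
  by rewrite addr0 /y eqxx seminorm_sgn.
have YE (w e : cube n) : NY (\sum_i sgn (e i) (T (sgn (w i) (y i)))) = NY (T x).
  rewrite (bigD1 k)//= big1 => [|i /negbTE ik]; last by rewrite /y ik sgn0 raddf0 sgn0.
  by rewrite addr0 /y eqxx seminorm_sgn// raddf_sgn seminorm_sgn.
have := H _ (mdiffs_sgn y).
rewrite (@eq_rexpect _ _ _ (fun=> NY (T x) `^ q)) => [|w]; last first.
  rewrite (@eq_rexpect _ _ _ (fun=> NY (T x) `^ q)) ?rexpect_cst ?card_cube_gt0//.
  by move=> e; rewrite YE.
rewrite (@eq_rexpect _ _ (fun w => NX _ `^ q) (fun=> NX x `^ q)) => [|w]; last first.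
  by rewrite XE.
rewrite !rexpect_cst ?card_cube_gt0// -powRM ?(seminorm_ge0 hX)//.
have cx0 : 0 <= c * NX x by rewrite mulr_ge0 ?(seminorm_ge0 hX).
have Tx0 : 0 <= NY (T x) by exact: seminorm_ge0.
by rewrite !leNgt; apply: contra; exact: lt_powR_base.
Qed.

(** The [p]-th power of the function S described above, restricted to the indices in [A]. *)
Definition sqfun (p : R) (d : 'I_n -> cube n -> X) (A : pred 'I_n) (w : cube n) : R :=
  rexpect (fun e : cube n => NY (\sum_(i < n | A i) sgn (e i) (T (d i w))) `^ p).

Lemma sqfun_ge0 p d A w : 0 <= sqfun p d A w.
Proof. by apply: rexpect_ge0 => e; exact: powR_ge0. Qed.

Lemma eq_sqfun p d (A B : pred 'I_n) w : A =1 B -> sqfun p d A w = sqfun p d B w.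
Proof.
by move=> AB; apply: eq_rexpect => e; congr (NY _ `^ p); exact: eq_bigl.
Qed.

Lemma sqfun_split p d (A B : pred 'I_n) w : 1 <= p ->
  sqfun p d A w <=
  2 `^ p * (sqfun p d (predI A B) w + sqfun p d (predI A (predC B)) w).
Proof.
move=> p1; have p0 : 0 <= p by lra.
rewrite -rexpectD -rexpectZ; apply: ler_rexpect => e.
rewrite (bigID B)/=.
apply: le_trans (powRD_le p0 (seminorm_ge0 hY _) (seminorm_ge0 hY _)).
by rewrite le_powR_base ?(seminorm_ge0 hY)// seminormD.
Qed.

(* The stopped martingale below is bounded and vanishes unless the square
   function exceeds l; it is predictable because the norm of the k-th difference
   depends only on the first k - 1 coordinates. *)
Lemma good_lambda_sqfun (p c t l : R) (d : 'I_n -> cube n -> X) :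
  1 < p -> 0 < c -> 0 < t -> t <= 1 -> 0 < l -> rumd_bound p c -> mdiffs d ->
  rexpect (fun w => ((12 * l < sqfun p d xpredT w `^ p^-1) &&
    (2 * c / t * runmax (fun m => NX (psum (d^~ w) m)) n <= l))%R%:R : R) <=
  (3 * t) `^ p * rexpect (fun w => (l < sqfun p d xpredT w `^ p^-1)%R%:R).
Proof.
move=> p1 c0 t0 t1 l0 Hp md; have p0 : 0 < p by lra.
pose x w m := NX (psum (d^~ w) m).
pose Q i w := sqfun p d (fun j => j < i)%N w.
pose S w := sqfun p d xpredT w `^ p^-1.
(* The level for which [2 * c / t * M* <= l] reads [M* <= D]. *)
pose D := t * l / (2 * c).
have D0 : 0 <= D by rewrite /D divr_ge0 ?mulr_ge0 ?ltW// mulr_gt0.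
(* [H] says that the process has started before the [i]-th difference, [A] that it has not yet been
   stopped. [A i] may inspect the norm of [d i] itself, as that norm is predictable. *)
pose H (i : 'I_n) w := l `^ p < Q i w.
pose A (i : 'I_n) w := (runmax (x w) i <= D) &&
  [forall j : 'I_n, (j <= i)%N ==> (NX (d j w) <= 2 * D)].
have pH : predictable H.
  move=> k w e we; rewrite /H; congr (_ < _); apply: eq_rexpect => s.
  congr (NY _ `^ p); apply: eq_bigr => i ik; congr (sgn _ (T _)).
  by apply: (md i).1; exact: agree_le we.
have pA : predictable A.
  move=> k w e we; congr andb.
    congr (_ <= D); apply: eq_runmax => j jk; congr NX.
    by apply: mdiffs_psum => //; exact: agree_le we.
  apply: eq_forallb => j; case: leqP => //= jk; congr (_ <= _).
  have [->//|->] := mdiffs_sign md (agree_le jk we); by rewrite seminormN.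
have Hinc w (i j : 'I_n) : (i <= j)%N -> H i w -> H j w.
  move=> ij /lt_le_trans; apply.
  apply: contraction_principle; rewrite ?(ltW p1)// => k ki.
  exact: leq_trans ij.
have Adec w (i j : 'I_n) : (i <= j)%N -> A j w -> A i w.
  move=> ij /andP[Dj /forallP dj]; apply/andP; split.
    by apply: le_trans Dj; exact: runmax_mono.
  apply/forallP => k; apply/implyP => ki.
  by apply: (implyP (dj k)); exact: leq_trans ij.
have Abound w i : A i w -> NX (psum (d^~ w) i) <= D /\ NX (d i w) <= 2 * D.
  move=> /andP[Di /forallP/(_ i)]; rewrite leqnn => di; split=> //.
  by apply: le_trans Di; exact: (le_runmax (x w)).
pose f i w := if H i w && A i w then d i w else 0.
have mf : mdiffs f.
  apply: mdiffs_stop => // k w e we; by rewrite (pH k w e)// (pA k w e).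
(* A difference of sums over two initial segments, each of norm at most [D + 2 * D]; this is the
   source of the bound [6 * D]. *)
have fE w : \sum_i f i w = \sum_(i < n | A i w) d i w -
    \sum_(i < n | ~~ H i w && A i w) d i w.
  rewrite -big_mkcond /= [in RHS](bigID (H^~ w))/=.
  rewrite -[X in _ = _ + X - _](eq_bigl _ _ (fun i => andbC (~~ H i w) (A i w))).
  by rewrite addrK; apply: eq_bigl => i; rewrite andbC.
have fbound w : NX (\sum_i f i w) `^ p <= (6 * D) `^ p * (l < S w)%R%:R.
  have [lS|Sl] := ltP l (S w); last first.
    rewrite mulr0 big1 ?(seminorm0 hX) ?powR0 ?gt_eqF// => i _.
    rewrite /f (_ : H i w = false)//; apply/negbTE; rewrite -leNgt.
    apply: (@le_trans _ _ (S w `^ p)).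
      rewrite powRVK ?gt_eqF ?sqfun_ge0//.
      by apply: contraction_principle => //; exact: ltW.
    by rewrite le_powR_base ?powR_ge0 ?(ltW p0).
  rewrite mulr1 le_powR_base ?(ltW p0) ?(seminorm_ge0 hX)// fE.
  apply: (le_trans (seminormD hX _ _)); rewrite seminormN//.
  have D20 : 0 <= 2 * D by rewrite mulr_ge0.
  have := seminorm_initial_sum hX D0 D20 (Adec w) (Abound w).
  have := @seminorm_initial_sum _ _ _ hX _ (d^~ w) (fun i => ~~ H i w && A i w)
    _ _ D0 D20.
  have dec (i j : 'I_n) : (i <= j)%N -> ~~ H j w && A j w -> ~~ H i w && A i w.
    move=> ij /andP[Hj Aj]; rewrite (Adec w i j)// andbT.
    by apply: contra Hj; exact: Hinc.
  by move=> /(_ dec (fun i HA => Abound w i (proj2 (andP HA)))); lra.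
have lp : 0 < l `^ p by rewrite powR_gt0.
rewrite -(ler_pM2l lp) mulrA -powRM ?(ltW l0) ?mulr_ge0 ?(ltW t0)//.
rewrite -[leLHS]rexpectZ.
have -> : l * (3 * t) = c * (6 * D).
  by rewrite /D; field; rewrite gt_eqF.
set P := rexpect (fun w => (l < sqfun p d xpredT w `^ p^-1)%R%:R).
have D60 : 0 <= 6 * D by lra.
rewrite (powRM _ (ltW c0) D60) -(mulrA _ _ P) -[_ * P]rexpectZ.
apply: le_trans (ler_wpM2l (powR_ge0 c p) (ler_rexpect fbound)).
apply: le_trans (Hp f mf); apply: ler_rexpect => w.
case: ltP => [big|_]; last first.
  by rewrite andFb mulr0; apply: rexpect_ge0 => e; exact: powR_ge0.
case: (leP (_ * runmax _ _)) => [small|_]; last first.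
  by rewrite andbF mulr0; apply: rexpect_ge0 => e; exact: powR_ge0.
rewrite /= mulr1.
have {}small : runmax (x w) n <= D.
  by rewrite /D ler_pdivlMr ?mulr_gt0// -ler_pdivrMl// mulrC -mulrA mulrCA mulrA mulrAC.
have xD m : (m <= n)%N -> x w m <= D.
  by move=> mn; apply: le_trans small; exact: le_runmax.
have dD j : NX (d j w) <= 2 * D.
  have -> : d j w = psum (d^~ w) j.+1 - psum (d^~ w) j by rewrite psumS addrC addKr.
  apply: (le_trans (seminormD hX _ _)); rewrite seminormN//.
  have := xD j.+1 (ltn_ord j); have := xD j (ltnW (ltn_ord j)).
  by rewrite /x; lra.
(* On the event considered, the process is never stopped. *)
have Aw i : A i w.
  apply/andP; split; last by apply/forallP => j; rewrite dD implybT.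
  by apply: le_trans small; apply: runmax_mono; exact: ltnW.
have -> : rexpect (fun e : cube n => NY (\sum_i sgn (e i) (T (f i w))) `^ p) =
    sqfun p d (H^~ w) w.
  apply: eq_rexpect => e; congr (NY _ `^ p); rewrite [in RHS]big_mkcond.
  apply: eq_bigr => i _; rewrite /f Aw andbT; case: ifP => // _.
  by rewrite raddf0; case: (e i); rewrite /= ?oppr0.
(* Up to the last index [k] before the start, the terms before [k] contribute at most [l ^ p], and
   the [k]-th has norm at most [c * (2 * D) = t * l <= l]. *)
have low : sqfun p d (fun i => ~~ H i w) w <= 2 `^ p * (l `^ p + l `^ p).
  have dec (i j : 'I_n) : (i <= j)%N -> ~~ H j w -> ~~ H i w.
    by move=> ij; apply: contra; exact: Hinc.
  have [B0|[k Bk BE]] := initial_segment dec.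
    rewrite (eq_sqfun p d w B0) /sqfun (@eq_rexpect _ _ _ (fun=> 0)) => [|e].
      by rewrite rexpect_cst ?card_cube_gt0// mulr_ge0 ?addr_ge0 ?powR_ge0.
    by rewrite big_pred0// (seminorm0 hY) powR0 ?gt_eqF.
  rewrite (eq_sqfun p d w BE).
  apply: (le_trans (sqfun_split _ _ (fun j : 'I_n => j < k)%N _ (ltW p1))).
  rewrite ler_wpM2l ?powR_ge0// lerD//.
    rewrite leNgt; apply: contra Bk => /lt_le_trans; apply.
    by apply: contraction_principle; rewrite ?(ltW p1)// => j /andP[].
  rewrite (@eq_sqfun p d _ (pred1 k)) => [|j]; last first.
    by rewrite /= -leqNgt -eqn_leq.
  rewrite -[leRHS](rexpect_cst _ (card_cube_gt0 n)); apply: ler_rexpect => e.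
  rewrite big_pred1_eq seminorm_sgn// le_powR_base ?(ltW p0) ?(seminorm_ge0 hY)//.
  apply: (le_trans (rumd_bound_norm k _ p0 (ltW c0) Hp)).
  apply: (@le_trans _ _ (c * (2 * D))); first by rewrite ler_pM2l.
  have -> : c * (2 * D) = t * l by rewrite /D; field; rewrite gt_eqF.
  by rewrite ger_pMl.
have Qbig : (12 * l) `^ p < sqfun p d xpredT w.
  rewrite -[ltRHS](@powRVK _ _ p) ?gt_eqF ?sqfun_ge0//.
  by apply: lt_powR_base => //; rewrite mulr_ge0// ltW.
have := lt_le_trans Qbig (sqfun_split d xpredT (H^~ w) w (ltW p1)).
rewrite (eq_sqfun p d w (fun i => andTb (H i w))).
rewrite (eq_sqfun p d w (fun i => andTb (~~ H i w))).
(* The outer factor 2 pays for splitting at the start and the inner one for [low]; [3 ^ p >= 3] then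
   leaves at least [l ^ p] after subtracting [2 * l ^ p]. *)
have -> : 12 * l = 2 * (3 * (2 * l)) by lra.
rewrite powRM ?mulr_ge0 ?(ltW l0)// ltr_pM2l ?powR_gt0// !powRM ?mulr_ge0 ?(ltW l0)//.
have h3 : 3 <= 3 `^ p :> R by apply: le1r_powR; lra.
have h2 : 1 <= 2 `^ p :> R by apply: le_trans (le1r_powR _ _); lra.
have h23 := ler_wpM2r (mulr_ge0 (powR_ge0 2 p) (ltW lp)) h3.
have h2l := ler_wpM2r (ltW lp) h2.
lra.
Qed.

End extrapolation.

Lemma rumd_extrapolation (R : realType) (p q : R) : 1 < p -> 1 < q ->
  exists2 C : R, 0 < C &
  forall n (X Y : zmodType) (NX : X -> R) (NY : Y -> R) (T : {additive X -> Y}) c,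
  seminorm NX -> seminorm NY -> 0 < c ->
  rumd_bound n NX NY T p c -> rumd_bound n NX NY T q (C * c).
Proof.
move=> p1 q1; have p0 : 0 < p by lra.
have q0 : 0 < q by lra.
have [K K0 HK] := kahane p1 q1.
(* The coefficient of [t ^ p] when [good_lambda] with [b = 12] meets the factor [(3 * t) ^ p]. *)
have A0 : 0 <= 2 * (2 * 12) `^ q * 3 `^ p by rewrite !mulr_ge0 ?powR_ge0.
have [t /andP[t0 t1] tA] := small_powR p0 A0.
(* The [q]-th power of the final constant: Kahane's constant, the good-lambda factor after
   absorption, and Doob's constant. *)
pose C := K * (4 * (2 * 12) `^ q * (2 / t) `^ q * (2 `^ q / (q - 1))).
have q10 : 0 < q - 1 by lra.
have C0 : 0 < C by rewrite /C !(mulr_gt0, powR_gt0, invr_gt0).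
exists (C `^ q^-1); first by rewrite powR_gt0.
move=> n X Y NX NY T c hX hY c0 Hp d md.
pose S w := sqfun NY T p d xpredT w `^ p^-1.
pose x w m := NX (psum (d^~ w) m).
rewrite powRM ?powR_ge0 ?(ltW c0)// powRVK ?gt_eqF ?(ltW C0)//.
have S0 w : 0 <= S w by exact: powR_ge0.
have x0 w m : 0 <= x w m by exact: seminorm_ge0.
have y0 w : 0 <= runmax (x w) n by apply: le_trans (le_runmax _ (leqnn n)).
have ct0 : 0 <= 2 * c / t by rewrite divr_ge0 ?mulr_ge0 ?ltW.
have D := doob hX q1 md.
have b12 : 0 < 12 :> R by [].
have GL := good_lambda (ltW q1) (powR_ge0 _ _) b12 S0 S0 (fun w => mulr_ge0 ct0 (y0 w))
  (fun l l0 => good_lambda_sqfun hX hY p1 c0 t0 t1 l0 Hp md).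
(* By the choice of [t], at most half of the left side reappears on the right; absorbing it turns
   the factor 2 into 4. *)
have {}GL : rexpect (fun w => S w `^ q) <=
    4 * (2 * 12) `^ q * ((2 * c / t) `^ q * rexpect (fun w => runmax (x w) n `^ q)).
  have Z0 : 0 <= rexpect (fun w => S w `^ q).
    by apply: rexpect_ge0 => w; exact: powR_ge0.
  have := ler_wpM2r Z0 tA; move: GL.
  rewrite (@eq_rexpect _ _ (fun w => (_ * _) `^ q)
    (fun w => (2 * c / t) `^ q * runmax (x w) n `^ q)) => [|w]; last by rewrite powRM.
  rewrite rexpectZ (powRM _ (ler0n R 3)) ?(ltW t0)//.
  move: (rexpect _) (rexpect _) ((2 * 12) `^ q) (3 `^ p) (t `^ p) (_ `^ q).
  by move=> *; nra.
(* Kahane's inequality is used pointwise in [w], for the vectors [T (d i w)]. *)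
apply: (@le_trans _ _ (K * rexpect (fun w => S w `^ q))).
  rewrite -rexpectZ; apply: ler_rexpect => w; exact: HK.
rewrite /C -!mulrA ler_pM2l//.
apply: (le_trans GL); rewrite -!mulrA !ler_pM2l ?powR_gt0//.
have -> : 2 * (c / t) = 2 / t * c by lra.
rewrite [leLHS](_ : _ = (2 / t) `^ q * (c `^ q * rexpect (fun w => runmax (x w) n `^ q))).
  rewrite ler_pM2l ?powR_gt0 ?divr_gt0//.
  rewrite !mulrA mulrAC; rewrite (mulrC _ (c `^ q)) -!mulrA.
  rewrite ler_pM2l ?powR_gt0//; move: D; rewrite -mulrA => /le_trans; apply.
  by rewrite (@eq_rexpect _ _ (fun w => NX (psum _ _) `^ q)
    (fun w => NX (\sum_i d i w) `^ q)) => [|w]; rewrite ?psum_full.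
by rewrite mulrA -powRM ?divr_ge0 ?(ltW c0) ?(ltW t0).
Qed.

(** * Martingales with respect to the coordinate filtration *)

Section filtration.

Lemma sigma_algebra_bigcup_count (T : Type) (I : countType) (G : set_system T)
    (F : I -> set T) :
  (forall i, <<s G >> (F i)) -> <<s G >> (\bigcup_i F i).
Proof.
move=> GF; pose F' m := if unpickle m is Some i then F i else set0.
have -> : \bigcup_i F i = \bigcup_m F' m.
  apply/seteqP; split=> t [i _ Fi]; first by exists (pickle i); rewrite // /F' pickleK.
  by move: Fi; rewrite /F'; case: (unpickle i) => // j Fj; exists j.
apply: sigma_algebra_bigcup => m; rewrite /F'.
by case: (unpickle m) => [i|]; [exact: GF|exact: sigma_algebra0].
Qed.

Lemma sigma_algebra_setC (T : Type) (G : set_system T) (A : set T) :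
  <<s G >> A -> <<s G >> (~` A).
Proof. by rewrite -setTD; exact: sigma_algebraCD. Qed.

(** Invariant sets form a sigma-algebra containing the generators. Conversely an atom is the
    complement of a countable union of generators, and an invariant set is the union of the atoms of
    its points. *)
Lemma coord_filtrationP n (k : nat) (A : set (cube n)) :
  coord_filtration n k A <-> forall w e, agree k w e -> A w -> A e.
Proof.
split=> [FA|HA].
  pose C := [set B : set (cube n) | forall w e, agree k w e -> B w -> B e].
  suff: C A by [].
  move: A FA; apply: smallest_sub.
    split=> [//|B CB w e we [_ nB]|B CB w e we [m _ Bw]].
      by split=> // Be; apply: nB; apply: (CB e w) => // i ik; rewrite we.
    by exists m => //; exact: CB Bw.
  by move=> B [i [b [ik ->]]] w e we /= <-; rewrite we.
have atom w : coord_filtration n k [set e | agree k w e].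
  pose F (i : 'I_n) : set (cube n) :=
    if (i < k)%N then [set e | e i = ~~ w i] else set0.
  have -> : [set e | agree k w e] = ~` (\bigcup_i F i).
    apply/seteqP; split=> [e we [i _]|e nF i ik].
      by rewrite /F; case: ifP => //= ik; rewrite (we _ ik); case: (e i).
    case E : (w i == e i); first exact/eqP.
    exfalso; apply: nF; exists i => //; rewrite /F ik /=.
    by move: E; case: (w i); case: (e i).
  apply: sigma_algebra_setC; apply: sigma_algebra_bigcup_count => i; rewrite /F.
  case: ifP => [ik|_]; last exact: sigma_algebra0.
  by apply: sub_gen_smallest; exists i, (~~ w i).
have -> : A = \bigcup_w (if w \in A then [set e | agree k w e] else set0).
  apply/seteqP; split=> [w Aw|e [w _]]; first by exists w; rewrite ?mem_set.
  by case: ifPn => // /set_mem Aw we; exact: HA Aw.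
apply: sigma_algebra_bigcup_count => w; case: ifP => _; first exact: atom.
exact: sigma_algebra0.
Qed.

(** Singletons are closed, hence Borel, so a measurable function is constant on atoms. *)
Lemma borel_measurable_coordP (K : numFieldType) (X : normedModType K) n (k : nat)
    (f : cube n -> X) :
  borel_measurable_wrt (coord_filtration n k) f <->
  forall w e, agree k w e -> f w = f e.
Proof.
split=> [mf w e we|Hf B _]; last first.
  by apply/coord_filtrationP => w e we /=; rewrite (Hf w e).
have B1 : <<s (@open X) >> [set f w].
  rewrite -[X in <<s _ >> X]setCK; apply: sigma_algebra_setC.
  apply: sub_gen_smallest; apply: closed_openC.
  by apply: accessible_closed_set1; apply: hausdorff_accessible; exact: norm_hausdorff.
by have /coord_filtrationP/(_ w e we)/(_ erefl)/= -> := mf _ B1.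
Qed.

End filtration.

Section walsh_paley.
Context (K : numFieldType) (X : normedModType K) (n : nat).

Lemma double_inj (x y : X) : x + x = y + y -> x = y.
Proof.
rewrite -!mulr2n -(scaler_nat 2 x) -(scaler_nat 2 y) => /scalerI; apply.
by rewrite pnatr_eq0.
Qed.

(** A set of the [k]-th sigma-algebra is invariant under [flip k], which changes the sign of the
    [k]-th difference; its integral over the set therefore vanishes. *)
Lemma mdiffs_walsh_paley (d : 'I_n -> cube n -> X) : mdiffs d ->
  walsh_paley_martingale (fun m w => psum (d^~ w) m).
Proof.
move=> md; have adapted m : borel_measurable_wrt (coord_filtration n m)
    (fun w => psum (d^~ w) m).
  by apply/borel_measurable_coordP => w e we; exact: mdiffs_psum.
split=> [m _|k kn]; first exact: adapted.
split; first exact: adapted.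
move=> A /coord_filtrationP HA; pose j := Ordinal kn.
have A_flip w : (flip j w \in A) = (w \in A).
  apply/idP/idP => /set_mem Aw; apply/mem_set.
    by apply: (HA (flip j w)) => // i ik; rewrite -(agree_flip j w).
  exact: (HA w _ (agree_flip j w)).
apply/esym/subr0_eq; rewrite /expect_on -sumrB.
rewrite (eq_bigr (fun w => (#|cube n|%:R^-1 : K) *: d j w)) => [|w _]; last first.
  by rewrite -scalerBr -[k]/(j : nat) psumS addrC addKr.
set s := \sum_(w | _) _; have sN : s = - s.
  rewrite -sumrN [LHS](reindex_inj (inv_inj (flipK j))).
  by apply: eq_big => [w|w _]; [exact: A_flip|rewrite (md j).2 scalerN].
by apply: double_inj; rewrite addr0 {1}sN addNr.
Qed.

(** The conditional expectation is tested on the atom of [w], where [M k] is constant and [M k.+1]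
    takes its values at [w] and at [flip k w], on two halves exchanged by the flip. *)
Lemma walsh_paley_mdiffs (M : nat -> cube n -> X) : walsh_paley_martingale M ->
  mdiffs (fun i : 'I_n => mdiff M i.+1).
Proof.
move=> [adapted condE] k.
have adP (m : nat) w e : (m <= n)%N -> agree m w e -> M m w = M m e.
  by move=> mn; move: w e; apply/borel_measurable_coordP; exact: adapted.
split=> [w e we|w].
  by rewrite /mdiff/= !(adP _ w e) ?(ltnW (ltn_ord k))//; exact: agree_le we.
suff H : M k.+1 w + M k.+1 (flip k w) = M k w + M k w.
  rewrite /mdiff/= -(adP k w) ?(ltnW (ltn_ord k))//; last exact: agree_flip.
  by apply/eqP; rewrite opprB subr_eq addrAC -H (addrC (M k.+1 w)) addrK.
pose A := [set e | agree k w e].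
have FA : coord_filtration n k A.
  apply/coord_filtrationP => e e' ee' we i ik; rewrite we//; exact: ee'.
have A_flip e : (flip k e \in A) = (e \in A).
  apply/idP/idP => /set_mem Aw; apply/mem_set => i ik; rewrite Aw//.
    by rewrite -(agree_flip k e).
  exact: agree_flip.
have [_ /(_ A FA)] := condE k (ltn_ord k); rewrite /expect_on.
set a := (_^-1 : K); set S1 := \sum_(t | _) _; set S2 := \sum_(t | _) _ => S12.
have /esym : S1 + S1 = S2 + S2 by rewrite S12.
have a0 : a != 0 by rewrite invr_eq0 pnatr_eq0 -lt0n card_cube_gt0.
(* Adding the sum to its flipped copy makes every summand on the atom the same, so the sums become
   multiples by the size of the atom. *)
rewrite {2}/S2 (reindex_inj (inv_inj (flipK k))) (eq_bigl _ _ A_flip).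
rewrite /S1 /S2 -!big_split /=.
rewrite (eq_bigr (fun=> a *: (M k.+1 w + M k.+1 (flip k w)))); last first.
  move=> e /set_mem we.
  rewrite -scalerDr; have [we'|we'] := agree_succ we.
    rewrite -(adP k.+1 w e)// -(adP k.+1 (flip k w) (flip k e))// => i ik.
    by rewrite !ffunE we'.
  rewrite -(adP k.+1 (flip k w) e)// -(adP k.+1 w (flip k e)) 1?addrC// => i ik.
  by rewrite ffunE -we'// ffunE addbK.
rewrite [RHS](eq_bigr (fun=> a *: (M k w + M k w))) => [|e /set_mem we]; last first.
  by rewrite -scalerDr -(adP k w e)// ltnW.
have cA : (#|[pred t | t \in A]|%:R : K) != 0.
  rewrite pnatr_eq0 -lt0n; apply/card_gt0P; exists w.
  by rewrite unfold_in; apply: mem_set.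
rewrite !sumr_const -(scaler_nat _ (a *: (M k w + _))).
rewrite -(scaler_nat _ (a *: (M k.+1 w + _))) => /(scalerI cA) H.
exact/esym/(scalerI a0).
Qed.

Lemma psum_mdiff (M : nat -> cube n -> X) (w : cube n) : M 0%N w = 0 ->
  \sum_(i < n) mdiff M i.+1 w = M n w.
Proof.
move=> M0; rewrite -(big_mkord xpredT (fun i => mdiff M i.+1 w)) /mdiff/=.
by rewrite (telescope_sumr (fun i => M i w)) // M0 subr0.
Qed.

End walsh_paley.

(** * Passage from the inequalities to the constants [RUMD] *)

Section RUMD.
Context (R : realType) (K : numFieldType) (re : K -> R).
Context (reD : forall a b, re (a + b) = re a + re b).
Context (re_le : forall a b, a <= b -> re a <= re b).

Definition renorm (X : normedModType K) (x : X) : R := re `|x|.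

Lemma renorm_seminorm (X : normedModType K) : seminorm (@renorm X).
Proof.
split=> [x y|x|x]; rewrite /renorm.
- by rewrite -reD; apply: re_le; exact: ler_normD.
- by rewrite normrN.
- by rewrite -mulr2n normrMn mulr2n reD mulr_natl mulr2n.
Qed.

Lemma sign_scale_sgn (X : normedModType K) (b : bool) (x : X) :
  (-1) ^+ b *: x = sgn b x.
Proof. by case: b; rewrite ?scaleN1r ?scale1r. Qed.

Lemma powRV_le_iff (a b c q : R) : 0 < q -> 0 <= a -> 0 <= b -> 0 < c ->
  (a `^ q^-1 <= c * b `^ q^-1) <-> (a <= c `^ q * b).
Proof.
move=> q0 a0 b0 c0.
have qn0 : q != 0 by rewrite gt_eqF.
have -> : c * b `^ q^-1 = (c `^ q * b) `^ q^-1.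
  by rewrite powRM ?powR_ge0// powRK// ltW.
have cb0 : 0 <= c `^ q * b by rewrite mulr_ge0 ?powR_ge0.
split=> [|ab]; last by rewrite le_powR_base ?invr_ge0 ?(ltW q0).
by rewrite !leNgt; apply: contra; apply: lt_powR_base; rewrite ?invr_gt0.
Qed.

(** The admissible constants are the same: partial sums turn differences into martingales, and
    increments lead back. *)
Lemma RUMDE (X Y : completeNormedModType K) (T : {linear X -> Y}) (q : R) n :
  0 < q ->
  RUMD re T q n = ereal_inf [set c%:E | c in [set c : R | 0 < c /\
    rumd_bound n (@renorm X) (@renorm Y) T q c]].
Proof.
move=> q0; congr ereal_inf; congr image; apply/seteqP.
have E0 (U : finType) (f : U -> R) : 0 <= rexpect (fun u => f u `^ q).
  by apply: rexpect_ge0 => u; exact: powR_ge0.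
have LHS (M : nat -> cube n -> X) (D : 'I_n -> cube n -> X) :
    (forall (k : 'I_n) w, mdiff M k.+1 w = D k w) ->
    rexpect (fun w => rexpect (fun e : cube n =>
      renorm (\sum_i sgn (e i) (T (D i w))) `^ q)) =
    rexpect (fun ew : cube n * cube n =>
      re `|\sum_(k < n) ((-1) ^+ ew.1 k : K) *: T (mdiff M k.+1 ew.2)| `^ q).
  move=> MD; rewrite -rexpect_exchange -rexpect_pair; apply: eq_rexpect => -[e w] /=.
  by congr (re `|_| `^ _); apply: eq_bigr => k _; rewrite MD sign_scale_sgn.
split=> c /= [c0 H]; split=> //.
  move=> d md; have := H _ (mdiffs_walsh_paley md) (fun w => psum0 (d^~ w)).
  move=> /(powRV_le_iff q0 (E0 _ _) (E0 _ _) c0).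
  rewrite -(LHS _ d) => [|k w]; last by rewrite /mdiff /= psumS addrC addKr.
  rewrite (@eq_rexpect _ _ (fun w => re `|psum (d^~ w) n| `^ q)
    (fun w => renorm (\sum_i d i w) `^ q))// => w.
  by rewrite psum_full.
move=> M wM M0; apply/(powRV_le_iff q0 (E0 _ _) (E0 _ _) c0).
rewrite -(LHS M (fun k => mdiff M k.+1))//.
apply: le_trans (H _ (walsh_paley_mdiffs wM)) _.
by rewrite (eq_rexpect (fun w => congr1 (fun x => renorm x `^ q) (psum_mdiff (M0 w)))).
Qed.

Lemma rumd_bound_le (X Y : normedModType K) (T : {linear X -> Y}) (q c c' : R) n :
  0 <= q -> 0 <= c -> c <= c' ->
  rumd_bound n (@renorm X) (@renorm Y) T q c ->
  rumd_bound n (@renorm X) (@renorm Y) T q c'.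
Proof.
move=> q0 c0 cc' H d md; apply: (le_trans (H d md)); rewrite ler_wpM2r//.
  by apply: rexpect_ge0 => w; exact: powR_ge0.
exact: le_powR_base.
Qed.

(** Multiplication by [C] maps the constants admissible for [p] to constants admissible for [q]. If
    there are none for [p], the right side is infinite. *)
Lemma le_RUMD (X Y : completeNormedModType K) (T : {linear X -> Y}) (p q C : R) n :
  0 < p -> 0 < q -> 0 < C ->
  (forall c, 0 < c -> rumd_bound n (@renorm X) (@renorm Y) T p c ->
    rumd_bound n (@renorm X) (@renorm Y) T q (C * c)) ->
  ((C^-1)%:E * RUMD re T q n <= RUMD re T p n)%E.
Proof.
move=> p0 q0 C0 H; rewrite !RUMDE//; apply/ereal_infP => _ [c [c0 Hc] <-].
rewrite lee_pdivrMl// -EFinM; apply: ereal_inf_lbound; exists (C * c) => //.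
by split; [rewrite mulr_gt0|exact: H].
Qed.

End RUMD.

(** Extrapolation is applied in both directions and the larger constant kept. It is chosen before
    [K] and [re], hence serves the real and the complex case together. *)
Lemma RUMD_equiv (R : realType) (p r : R) : 1 < p -> 1 < r ->
  exists2 c : R, 0 < c &
  forall (K : numFieldType) (re : K -> R) (X Y : completeNormedModType K)
    (T : {linear X -> Y}) n,
  (forall a b, re (a + b) = re a + re b) -> (forall a b, a <= b -> re a <= re b) ->
  ((c^-1)%:E * RUMD re T p n <= RUMD re T r n)%E /\
  (RUMD re T r n <= c%:E * RUMD re T p n)%E.
Proof.
move=> p1 r1; have [C C0 HC] := rumd_extrapolation p1 r1.
have [C' C'0 HC'] := rumd_extrapolation r1 p1.
have c0 : 0 < Num.max C C' by rewrite lt_max C0.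
exists (Num.max C C') => // K re X Y T n reD re_le.
have hX := renorm_seminorm reD re_le X; have hY := renorm_seminorm reD re_le Y.
have p0 : 0 < p by lra.
have r0 : 0 < r by lra.
split; last rewrite -lee_pdivrMl//; apply: le_RUMD => // b b0 Hb.
  apply: (rumd_bound_le (ltW p0) _ _ (HC' _ _ _ _ _ _ _ hX hY b0 Hb)).
    by rewrite mulr_ge0 ?ltW.
  by rewrite ler_pM2r// le_max lexx orbT.
apply: (rumd_bound_le (ltW r0) _ _ (HC _ _ _ _ _ _ _ hX hY b0 Hb)).
  by rewrite mulr_ge0 ?ltW.
by rewrite ler_pM2r// le_max lexx.
Qed.

Theorem theorem2p4 (R : realType) (p r : R) (hp : 1 < p) (hpr : p < r) :
  exists c : R, 0 < c /\
    (forall (X Y : completeNormedModType R) (T : {linear X -> Y}),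
       bounded_near T (nbhs (0 : X)) ->
       forall n : nat, (0 < n)%N ->
         ((c^-1)%:E * RUMD id T p n <= RUMD id T r n)%E /\
         (RUMD id T r n <= c%:E * RUMD id T p n)%E) /\
    (forall (X Y : completeNormedModType R[i]) (T : {linear X -> Y}),
       bounded_near T (nbhs (0 : X)) ->
       forall n : nat, (0 < n)%N ->
         ((c^-1)%:E * RUMD (@complex.Re R) T p n <= RUMD (@complex.Re R) T r n)%E /\
         (RUMD (@complex.Re R) T r n <= c%:E * RUMD (@complex.Re R) T p n)%E).
Proof.
have [c c0 H] := RUMD_equiv hp (lt_trans hp hpr).
exists c; split=> //; split=> X Y T _ n _; apply: H => //.
  by case=> [a a'] [b b'].
(* The order on [R[i]] compares real parts of numbers with equal imaginary parts. *)
by move=> a b; rewrite lecE => /andP[].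
Qed.
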